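(* Let $k \ge 1$ be an integer, and let $P(k,k)$ denote the probability that the two-player M\&M Game, played with fair coins and with both players starting with $k$ M\&M's, ends in a tie. Then $$P(k,k) \;=\; \sum_{n=0}^{k-1} \binom{2k-n-2}{n} \left(\frac{1}{3}\right)^n \binom{2k-2n-2}{k-n-1} \left(\frac{1}{3}\right)^{k-n-1} \left(\frac{1}{3}\right)^{k-n-1} \frac{1}{3}.$$
   Context: The two-player M\&M Game: each of two players starts with a given number of M\&M's (here both start with $k$). In each round $n=1,2,3,\dots$ both players simultaneously toss a fair coin; all tosses (of both players and over all rounds) are independent, each being heads with probability $1/2$. A player who tosses a head eats one of their M\&M's (if they have any left); a player who tosses a tail does not eat. Play continues until no one has any M\&M's left. The game ends in a tie if both players eat their last M\&M in the same round, i.e. if the round in which the first player tosses their $k$-th head equals the round in which the second player tosses their $k$-th head. $\binom{n}{r} = \frac{n!}{r!(n-r)!}$ is the binomial coefficient. *)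

(* Defs.v *)
From HB Require Import structures.
From mathcomp Require Import all_boot all_order all_algebra finmap.
From mathcomp Require Import all_classical all_reals all_analysis.

Set Implicit Arguments.
Unset Strict Implicit.
Unset Printing Implicit Defensive.

Import Order.TTheory GRing.Theory Num.Theory.

Local Open Scope classical_set_scope.
Local Open Scope ring_scope.

Definition mutually_independent (d d' : measure_display)
    (T : measurableType d) (T' : measurableType d') (R : realType)
    (P : probability T R) (I : choiceType) (X : I -> {RV P >-> T'}) : Prop :=
  forall (J : {fset I}) (B : I -> set T'),
    (forall i, measurable (B i)) ->
    P (\bigcap_(i in [set` J]) X i @^-1` B i) =
      (\prod_(i <- J) P (X i @^-1` B i))%E.

(* [X (i, n)] is the toss of player [i] in round [n.+1]; [true] is heads. *)
Definition fair_coin_tosses (d : measure_display) (T : measurableType d)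
    (R : realType) (P : probability T R)
    (X : ('I_2 * nat)%type -> {RV P >-> bool}) : Prop :=
  mutually_independent X /\
  (forall j, P (X j @^-1` [set true]) = (1 / 2)%:E).

(* M&M's left after [n] rounds to a player who starts with [m] of them and
   tosses [c 0], [c 1], ...; the truncated predecessor encodes "if any left". *)
Fixpoint remaining (m : nat) (c : nat -> bool) (n : nat) : nat :=
  if n is n'.+1 then
    if c n' then (remaining m c n').-1 else remaining m c n'
  else m.

Definition eats_last (m : nat) (c : nat -> bool) (n : nat) : bool :=
  (0 < n)%N && (0 < remaining m c n.-1)%N && (remaining m c n == 0)%N.

Definition tie (T : Type) (m : 'I_2 -> nat) (X : ('I_2 * nat)%type -> T -> bool) :
    set T :=
  [set w | exists n : nat,
     forall i : 'I_2, eats_last (m i) (fun r => X (i, r) w) n].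

(* Main.v *)
(* With k = j + 1, the game is tied in round m + 1 exactly when each player has
   tossed j heads in the first m rounds and heads in round m + 1, which has
   probability C(m, j)^2 / 4^(m + 1).  Vandermonde's identity expands C(m, j)^2
   as the sum over n of C(j, n) C(2j - n, j) C(m, 2j - n), and summing over m
   with sum_m C(m, t) / 4^(m + 1) = 1 / 3^(t + 1) gives the formula. *)
Require Import Defs.
From HB Require Import structures.
From mathcomp Require Import all_boot all_order all_algebra finmap.
From mathcomp Require Import all_classical all_reals all_analysis.
From mathcomp Require Import zify ring lra.

Set Implicit Arguments.
Unset Strict Implicit.
Unset Printing Implicit Defensive.

Import Order.TTheory GRing.Theory Num.Theory.
Import numFieldNormedType.Exports.

Local Open Scope classical_set_scope.
Local Open Scope ring_scope.

(** * Identities and bounds for binomial coefficients *)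

Lemma leq_bin_exp2 m t : ('C(m, t) <= 2 ^ m)%N.
Proof.
elim: m t => [|m IHm] [|t] //; first by rewrite bin0 expn_gt0.
by rewrite binS expnS mul2n -addnn leq_add.
Qed.

(** Both sides count ways to choose disjoint sets of sizes [i] and [l] among [m] points. In the main
    case, multiplying by [i! l! (m - i - l)!] turns each side into [m!]. *)
Lemma bin_mul_subl m i l :
  ('C(m, i) * 'C(m - i, l) = 'C(m, i + l) * 'C(i + l, i))%N.
Proof.
have [->|l0] := posnP l; first by rewrite addn0 bin0 binn.
have [lem|ltm] := leqP (i + l) m; last first.
  by rewrite (bin_small ltm) (@bin_small (m - i)) ?muln0//; lia.
have lim : (i <= m)%N by lia.
have lml : (l <= m - i)%N by lia.
have := bin_fact lim; have := bin_fact lml.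
have := bin_fact lem; have := bin_fact (leq_addr l i).
rewrite addKn -subnDA => e1 e2 e3 e4.
apply/eqP; rewrite -(@eqn_pmul2r (i`! * l`! * (m - (i + l))`!)) ?muln_gt0 ?fact_gt0//.
apply/eqP; transitivity m`!; first by rewrite -e4 -e3; ring.
by rewrite -e2 -e1; ring.
Qed.

(* Vandermonde: split a [j]-subset of [m] points along a fixed [i]-subset. *)
Lemma bin_mul_expand m i j :
  ('C(m, i) * 'C(m, j) =
   \sum_(n < j.+1) 'C(i, n) * ('C(m, i + (j - n)) * 'C(i + (j - n), i)))%N.
Proof.
have [lim|lmi] := leqP i m; last first.
  rewrite bin_small// mul0n big1// => n _.
  by rewrite (@bin_small m) ?muln0//; lia.
rewrite -{2}(subnKC lim) -binomial.Vandermonde big_distrr/=.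
by apply: eq_bigr => n _; rewrite mulnCA bin_mul_subl.
Qed.

(** Both sides are the trinomial coefficient [(2j - n)! / (n! (j - n)! (j - n)!)]; this brings the
    Vandermonde coefficients to the shape in the theorem. *)
Lemma bin_trinomial j n : (n <= j)%N ->
  ('C(j, n) * 'C(j + (j - n), j) =
   'C(j + (j - n), n) * 'C((j - n) + (j - n), j - n))%N.
Proof.
move=> lnj; have := bin_mul_subl (j + (j - n)) n (j - n).
rewrite subnKC//.
have -> : (j + (j - n) - n = (j - n) + (j - n))%N by lia.
by move=> ->; rewrite mulnC.
Qed.

(** * Series of binomial coefficients weighted by powers of 1/4 *)

Section binomial_series.
Variable R : realType.

Lemma cvg_bin_geo0 t : (fun N => 'C(N, t)%:R / 4 ^+ N : R) @ \oo --> (0 : R).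
Proof.
apply: (@squeeze_cvgr _ _ _ _ (fun=> 0) (fun N => (1 / 2) ^+ N)).
- near=> N; rewrite divr_ge0 ?exprn_ge0//= ler_pdivrMr ?exprn_gt0//.
  rewrite -exprMn (_ : 1 / 2 * 4 = 2%:R); last by field.
  by rewrite -natrX ler_nat leq_bin_exp2.
- exact: cvg_cst.
- by apply: cvg_expr; rewrite ger0_norm; lra.
Unshelve. all: by end_near. Qed.

(* The partial sums satisfy [3 S_N (t + 1) = S_N t - C(N, t + 1) / 4 ^ N]. *)
Lemma cvg_bin_series t :
  series (fun m => 'C(m, t)%:R / 4 ^+ m.+1 : R) @ \oo --> ((1 / 3) ^+ t.+1 : R).
Proof.
elim: t => [|t IHt].
  (* A geometric sum; its remainder keeps the factor ['C(N, 0)], equal to 1, so that [cvg_bin_geo0]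
     applies. *)
  rewrite (_ : series _ = fun N => 1 / 3 - 1 / 3 * ('C(N, 0)%:R / 4 ^+ N)).
    rewrite (_ : (1 / 3) ^+ 1 = 1 / 3 - 1 / 3 * 0 :> R); last by ring.
    by apply: cvgB; [exact: cvg_cst|apply: cvgMr; exact: cvg_bin_geo0].
  apply/funext => N; rewrite /series/=; elim: N => [|N IHN].
    by rewrite big_nil bin0 expr0; field.
  rewrite big_nat_recr//= IHN !bin0 exprS.
  have : 4 ^+ N != 0 :> R by rewrite expf_neq0.
  by move: (4 ^+ N) => x x0; field.
rewrite (_ : series _ = fun N => 1 / 3 *
   series (fun m => 'C(m, t)%:R / 4 ^+ m.+1 : R) N
   - 1 / 3 * ('C(N, t.+1)%:R / 4 ^+ N)).
  rewrite (_ : (1 / 3) ^+ t.+2 = 1 / 3 * (1 / 3) ^+ t.+1 - 1 / 3 * 0 :> R);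
    last by rewrite mulr0 subr0 exprS.
  by apply: cvgB; apply: cvgMr; [exact: IHt|exact: cvg_bin_geo0].
apply/funext => N; rewrite /series/=; elim: N => [|N IHN].
  by rewrite !big_nil bin0n/= expr0; field.
rewrite !big_nat_recr//= IHN binS natrD exprS.
have : 4 ^+ N != 0 :> R by rewrite expf_neq0.
by move: (4 ^+ N) => x x0; field.
Qed.

(** By [bin_mul_expand] the partial sums are a fixed finite combination of those in
    [cvg_bin_series], so the limit is taken term by term. *)
Lemma cvg_bin_mul_series i j :
  series (fun m => ('C(m, i) * 'C(m, j))%:R / 4 ^+ m.+1 : R) @ \oo -->
  (\sum_(n < j.+1)
     ('C(i, n) * 'C(i + (j - n), i))%:R * (1 / 3) ^+ (i + (j - n)).+1 : R).
Proof.
rewrite (_ : series _ = fun N => \sum_(n < j.+1)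
   ('C(i, n) * 'C(i + (j - n), i))%:R *
   series (fun m => 'C(m, i + (j - n))%:R / 4 ^+ m.+1 : R) N).
  apply: cvg_big => [|n _]; [exact: add_continuous|apply: cvgMr]; exact: cvg_bin_series.
apply/funext => N; rewrite /series/=.
under [RHS]eq_bigr do rewrite mulr_sumr.
rewrite exchange_big/=; apply: eq_bigr => m _.
rewrite bin_mul_expand natr_sum mulr_suml; apply: eq_bigr => n _.
rewrite !natrM; ring.
Qed.

Lemma tie_sum_trinomial (k : nat) : (1 <= k)%N ->
  \sum_(n < k.-1.+1) ('C(k.-1, n) * 'C(k.-1 + (k.-1 - n), k.-1))%:R
     * (1 / 3) ^+ (k.-1 + (k.-1 - n)).+1 =
  \sum_(0 <= n < k)
       'C(2 * k - n - 2, n)%:R * (1 / 3) ^+ n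
       * 'C(2 * k - 2 * n - 2, k - n - 1)%:R
       * (1 / 3) ^+ (k - n - 1) * (1 / 3) ^+ (k - n - 1) * (1 / 3) :> R.
Proof.
case: k => // j _; rewrite big_mkord /=; apply: eq_bigr => n _.
have lnj : (n <= j)%N by rewrite -ltnS.
rewrite bin_trinomial// natrM.
have -> : (j.+1 - n - 1 = j - n)%N by lia.
have -> : (2 * j.+1 - n - 2 = j + (j - n))%N by lia.
have -> : (2 * j.+1 - 2 * n - 2 = (j - n) + (j - n))%N by lia.
(* This splits the exponent [2j - n + 1] as [n + (j - n) + (j - n) + 1]. *)
have e : (1 / 3) ^+ j = (1 / 3) ^+ n * (1 / 3) ^+ (j - n) :> R.
  by rewrite -exprD subnKC.
rewrite exprS exprD e; ring.
Qed.
End binomial_series.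

(** * The last M&M along a fixed sequence of tosses *)

Lemma remainingE m c n : remaining m c n = (m - \sum_(r < n) c r)%N.
Proof.
elim: n => [|n IHn] /=; first by rewrite big_ord0 subn0.
by rewrite big_ord_recr /= IHn; case: (c n) => /=; lia.
Qed.

Lemma eats_last_S k c n :
  eats_last k.+1 c n.+1 = (\sum_(r < n) c r == k)%N && c n.
Proof.
rewrite /eats_last !remainingE big_ord_recr /=.
by move: (\sum_(r < n) c r)%N => s; case: (c n) => /=; lia.
Qed.

(** The head in the earlier round raises the count above [k], and counts of heads never decrease.
    This makes ties in different rounds disjoint. *)
Lemma eats_last_inj k c n n' :
  eats_last k.+1 c n.+1 -> eats_last k.+1 c n'.+1 -> n = n'.
Proof.
wlog lnn' : n n' / (n < n')%N => [wl h h'|].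
  case: (ltngtP n n') => // [/wl|/wl h'']; first exact.
  by rewrite h''.
rewrite !eats_last_S => /andP[/eqP <- cn] /andP[/eqP + _].
rewrite -(subnKC lnn') big_split_ord big_ord_recr /= cn; lia.
Qed.

(** * Probability of a tie in a given round, and of a tie *)

Section tosses.
Context (d : measure_display) (T : measurableType d) (R : realType)
  (P : probability T R) (X : ('I_2 * nat)%type -> {RV P >-> bool}).
Hypothesis hX : fair_coin_tosses X.

Lemma fair_coinE j (b : bool) : P (X j @^-1` [set b]) = (1 / 2)%:E.
Proof.
case: b; first exact: hX.2.
rewrite (_ : _ @^-1` _ = ~` (X j @^-1` [set true])); last first.
  by apply/seteqP; split => w /=; case: (X j w).
rewrite probability_setC ?hX.2; last exact: measurable_funPTI.
by rewrite -EFinB; congr _%:E; field.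
Qed.

Definition rounds n : {fset ('I_2 * nat)%type} :=
  [fset (ir.1, val ir.2) | ir in {: 'I_2 * 'I_n}]%fset.

Lemma mem_rounds n i r : ((i, r) \in rounds n) = (r < n)%N.
Proof.
apply/imfsetP/idP => [[[i' r'] _ [_ ->]] //|lrn].
by exists (i, Ordinal lrn).
Qed.

Lemma card_rounds n : #|` rounds n| = (2 * n)%N.
Proof.
rewrite card_imfset /= -?cardE ?card_prod ?card_ord//.
by move=> [i r] [i' r'] [-> /val_inj ->].
Qed.

Lemma prob_rounds n (c : 'I_2 -> nat -> bool) :
  P [set w | forall i r, (r < n)%N -> X (i, r) w = c i r] = (1 / 4 ^+ n)%:E.
Proof.
have := hX.1 (rounds n) (fun ir => [set c ir.1 ir.2]) (fun=> I).
rewrite (_ : \bigcap_(_ in _) _ =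
  [set w | forall i r, (r < n)%N -> X (i, r) w = c i r]); last first.
  apply/seteqP; split => [w h i r lrn|w h [i r]] /=.
    by apply: (h (i, r)); rewrite /= mem_rounds.
  by rewrite mem_rounds; exact: h.
move=> ->; under eq_bigr do rewrite fair_coinE.
(* Two players over [n] rounds make [2 * n] independent tosses, whence [(1 / 2) ^+ (2 * n)]. *)
rewrite prodEFin big_const_seq count_predT card_rounds; congr _%:E.
rewrite iter_mulr_1 exprM (_ : (1 / 2) ^+ 2 = 4^-1); last by field.
by rewrite exprVn div1r.
Qed.

Definition tie_round k n : set T :=
  [set w | forall i, eats_last k.+1 (fun r => X (i, r) w) n.+1].

(* A pattern gives, for each player, the rounds before the [n.+1]-st (the round
   of the tie) in which this player tosses heads. *)
Definition patterns k n : seq {ffun 'I_2 -> {set 'I_n}} :=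
  enum (ffun_on [pred A : {set 'I_n} | #|A| == k]).

(** The index [r = n] lies outside ['I_n]; the default [true] there is the head that both players
    toss in the round of the tie. *)
Definition pattern_toss n (f : {ffun 'I_2 -> {set 'I_n}}) (i : 'I_2) (r : nat) :
  bool := if insub r is Some s then s \in f i else true.

Definition pattern_event n (f : {ffun 'I_2 -> {set 'I_n}}) : set T :=
  [set w | forall i r, (r < n.+1)%N -> X (i, r) w = pattern_toss f i r].

Lemma pattern_toss_ord n (f : {ffun 'I_2 -> {set 'I_n}}) i (s : 'I_n) :
  pattern_toss f i s = (s \in f i).
Proof. by rewrite /pattern_toss valK. Qed.

Lemma pattern_toss_last n (f : {ffun 'I_2 -> {set 'I_n}}) i :
  pattern_toss f i n.
Proof. by rewrite /pattern_toss insubN// ltnn. Qed.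

Lemma tie_roundE k n :
  tie_round k n = \bigcup_(f in [set` patterns k n]) pattern_event f.
Proof.
apply/seteqP; split => [w h|w [f /= ]].
  exists [ffun i => [set s : 'I_n | X (i, val s) w]]%SET.
    rewrite /= mem_enum; apply/ffun_onP => i; rewrite ffunE inE /=.
    have := h i; rewrite eats_last_S => /andP[/eqP <- _].
    rewrite -sum1_card big_mkcond; apply/eqP/eq_bigr => s _.
    by rewrite inE; case: (X _ _).
  move=> i r; rewrite ltnS leq_eqVlt => /orP[/eqP ->|lrn].
    by have := h i; rewrite pattern_toss_last eats_last_S => /andP[_ ->].
  by rewrite (pattern_toss_ord _ _ (Ordinal lrn)) ffunE inE.
rewrite mem_enum => /ffun_onP fk h i; rewrite eats_last_S; apply/andP; split.
  have := fk i; rewrite inE /= => /eqP <-.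
  apply/eqP; rewrite -sum1_card [RHS]big_mkcond; apply: eq_bigr => s _.
  have -> : X (i, val s) w = (s \in f i); last by case: (s \in f i).
  by rewrite (h i s (ltnW (ltn_ord s))) pattern_toss_ord.
by rewrite h// pattern_toss_last.
Qed.

Lemma measurable_pattern_event n (f : {ffun 'I_2 -> {set 'I_n}}) :
  measurable (pattern_event f).
Proof.
rewrite (_ : pattern_event f = \bigcap_(ir in [set` rounds n.+1])
   X ir @^-1` [set pattern_toss f ir.1 ir.2]).
  by apply: fin_bigcap_measurable => // ir _; exact: measurable_funPTI.
apply/seteqP; split => [w h [i r]|w h i r lrn] /=.
  by rewrite mem_rounds; exact: h.
by apply: (h (i, r)); rewrite /= mem_rounds.
Qed.

(** The tosses of the first [n] rounds determine the pattern. *)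
Lemma trivIset_pattern_event n D : trivIset D (@pattern_event n).
Proof.
move=> f g _ _ [w [hf hg]]; apply/ffunP => i; apply/setP => s.
have lsn : (s < n.+1)%N by rewrite ltnW// ltnS.
by have := hf i s lsn; rewrite (hg i s lsn) !pattern_toss_ord.
Qed.

Lemma prob_tie_round k n :
  P (tie_round k n) = (('C(n, k) * 'C(n, k))%:R / 4 ^+ n.+1)%:E.
Proof.
rewrite tie_roundE measure_fin_bigcup//; last 2 first.
- exact: trivIset_pattern_event.
- by move=> f _; exact: measurable_pattern_event.
rewrite -fsbig_seq ?enum_uniq//.
rewrite (eq_bigr (fun=> (1 / 4 ^+ n.+1)%:E)) => [|f _];
  last exact: (prob_rounds n.+1 (pattern_toss f)).
(* All patterns are equally likely, so it remains to count them: each of the two players has a free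
   choice of a [k]-subset of ['I_n]. *)
rewrite sumEFin big_const_seq count_predT -cardE card_ffun_on card_ord.
rewrite iter_addr_0 (_ : #|_| = 'C(n, k)); last first.
  by rewrite -[X in 'C(X, _)](card_ord n) -card_draws; apply: eq_card => A; rewrite !inE.
by congr _%:E; rewrite -[LHS]mulr_natl mulrA mulr1 mulnn.
Qed.

Lemma tieE k : tie (fun=> k.+1) X = \bigcup_n tie_round k n.
Proof.
apply/seteqP; split => [w [[|n] h]|w [n _ h]]; last by exists n.+1.
  (* No tie occurs at index 0, since [eats_last] requires a positive round. *)
  by have := h ord0.
by exists n.
Qed.

Lemma prob_tie k :
  P (tie (fun=> k.+1) X) =
  (\sum_(n < k.+1) ('C(k, n) * 'C(k + (k - n), k))%:R
     * (1 / 3) ^+ (k + (k - n)).+1)%:E.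
Proof.
rewrite tieE measure_bigcup; last 2 first.
- move=> n _; rewrite tie_roundE; apply: fin_bigcup_measurable => // f _.
  exact: measurable_pattern_event.
(* One player alone already fixes the round of the tie. *)
- move=> n n' _ _ [w [/(_ ord0) h /(_ ord0) h']]; exact: eats_last_inj h h'.
apply: cvg_lim => //.
rewrite (_ : (fun N => _) = EFin \o series
    (fun m => ('C(m, k) * 'C(m, k))%:R / 4 ^+ m.+1 : R)).
  by apply: cvg_EFin; [exact: nearW|exact: cvg_bin_mul_series].
apply/funext => N /=; rewrite /series /= -sumEFin.
by apply: eq_big => [m|m _]; rewrite ?in_setT// prob_tie_round.
Qed.
End tosses.

Theorem theorem3p1 (d : measure_display) (T : measurableType d) (R : realType)
    (P : probability T R) (X : ('I_2 * nat)%type -> {RV P >-> bool})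
    (hX : fair_coin_tosses X) (k : nat) (hk : (1 <= k)%N) :
  P (tie (fun _ : 'I_2 => k) X) =
    (\sum_(0 <= n < k)
       'C(2 * k - n - 2, n)%:R * (1 / 3) ^+ n
       * 'C(2 * k - 2 * n - 2, k - n - 1)%:R
       * (1 / 3) ^+ (k - n - 1) * (1 / 3) ^+ (k - n - 1) * (1 / 3) : R)%:E.
Proof.
by case: k hk => // k _; rewrite prob_tie// -[k]/(k.+1.-1) tie_sum_trinomial.
Qed.
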